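(* Let $L$ be an $n$-dimensional non-abelian nilpotent Lie algebra of nilpotency class $c$ with derived subalgebra $L^2$ of dimension $m$, and let $t=\dim \big(Z(L)/(Z(L)\cap L^2)\big)$. Then \[\dim \mathcal{M}(L)\leq \frac{1}{2}(n+m-2)(n-m-1)-t(m-1)+1.\] In particular, when $m=1$ the bound is attained if and only if $L\cong H(1)\oplus A(n-3)$.
   Context: Lie algebras are over a fixed field. $L^2=[L,L]$ is the derived subalgebra and $Z(L)$ the center. The Schur multiplier of $L$ is the abelian Lie algebra $\mathcal{M}(L)=(R\cap F^2)/[R,F]$, where $L\cong F/R$ with $F$ a free Lie algebra (independent of the choice of free presentation up to isomorphism). $A(k)$ denotes the abelian Lie algebra of dimension $k$. $H(1)$ is the Heisenberg Lie algebra of dimension $3$, with basis $x,y,z$ and only non-zero product of basis elements $[x,y]=z$. *)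

(* Defs.v *)
From HB Require Import structures.
From mathcomp Require Import all_boot all_order all_algebra.
From mathcomp Require Import boolp classical_sets.

Set Implicit Arguments.
Unset Strict Implicit.
Unset Printing Implicit Defensive.

Import Order.TTheory GRing.Theory Num.Theory.
Local Open Scope ring_scope.
Local Open Scope classical_set_scope.

(* The bracket is alternating, [x, x] = 0, which in characteristic 2 is
   stronger than antisymmetry. *)
HB.mixin Record Lmodule_isLieAlgebra (K : fieldType) L of GRing.Lmodule K L := {
  lie : L -> L -> L;
  lie_linear_l : forall y : L, linear (fun x => lie x y);
  lie_linear_r : forall x : L, linear (fun y => lie x y);
  lie_alternating : forall x : L, lie x x = 0;
  lie_jacobi : forall x y z : L,
    lie x (lie y z) + lie y (lie z x) + lie z (lie x y) = 0
}.

#[short(type="lieAlgType")]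
HB.structure Definition LieAlgebra (K : fieldType) :=
  {L of GRing.Lmodule K L & Lmodule_isLieAlgebra K L}.

(* Finite-dimensional Lie algebras. *)
#[short(type="lieVectType")]
HB.structure Definition LieVect (K : fieldType) :=
  {L of Vector K L & Lmodule_isLieAlgebra K L}.

Definition lie_morphism (K : fieldType) (L M : lieAlgType K)
    (f : {linear L -> M}) : Prop :=
  forall x y : L, f (lie x y) = lie (f x) (f y).

Definition lie_isomorphic (K : fieldType) (L M : lieAlgType K) : Prop :=
  exists f : {linear L -> M}, lie_morphism f /\ bijective f.

Section BracketLinear.
Variables (K : fieldType) (L : lieAlgType K).

HB.instance Definition _ (x : L) :=
  GRing.isLinear.Build K L L *:%R (lie x) (lie_linear_r x).

End BracketLinear.

(* Subspaces of a space of arbitrary dimension, as sets of vectors. *)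
Section Subspaces.
Variables (K : fieldType) (V : lmodType K).

Definition linear_span (S : set V) : set V :=
  [set v | exists (k : nat) (a : 'I_k -> K) (s : 'I_k -> V),
    (forall j, S (s j)) /\ v = \sum_(j < k) a j *: s j].

(* For subspaces B `<=` A: the space A / B has dimension d, i.e. some
   v_0, ..., v_(d-1) in A induce a basis of A / B. *)
Definition quot_dim (A B : set V) (d : nat) : Prop :=
  exists v : 'I_d -> V,
    [/\ forall j, A (v j),
        forall a : 'I_d -> K, B (\sum_(j < d) a j *: v j) ->
          forall j, a j = 0
      & forall x, A x ->
          exists a : 'I_d -> K, B (x - \sum_(j < d) a j *: v j)].

End Subspaces.

Section Free.
Variable K : fieldType.

(* [A, B], the subspace spanned by all brackets. *)
Definition lie_prod (L : lieAlgType K) (A B : set L) : set L :=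
  linear_span [set z | exists x y : L, [/\ A x, B y & z = lie x y]].

Definition lie_kernel (F L : lieAlgType K) (p : {linear F -> L}) : set F :=
  [set x | p x = 0].

Definition is_free_lie (X : Type) (F : lieAlgType K) (i : X -> F) : Prop :=
  forall (M : lieAlgType K) (f : X -> M),
    exists phi : {linear F -> M},
      [/\ lie_morphism phi,
          forall x, phi (i x) = f x
        & forall psi : {linear F -> M}, lie_morphism psi ->
            (forall x, psi (i x) = f x) -> psi =1 phi].

Definition free_presentation (X : Type) (F L : lieAlgType K) (i : X -> F)
    (p : {linear F -> L}) : Prop :=
  [/\ is_free_lie i, lie_morphism p & forall y : L, exists x : F, p x = y].

(* dim (R `&` F^2) / [R, F] = d, for R the kernel of p : F -> L. *)
Definition schur_multiplier_dim (F L : lieAlgType K) (p : {linear F -> L})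
    (d : nat) : Prop :=
  let R := lie_kernel p in
  quot_dim (R `&` lie_prod setT setT) (lie_prod R setT) d.

End Free.

Section FiniteDimensional.
Variables (K : fieldType) (L : lieVectType K).

Definition lie_prodv (U V : {vspace L}) : {vspace L} :=
  <<[seq lie u v | u <- vbasis U, v <- vbasis V]>>%VS.

Definition lie_derived : {vspace L} := lie_prodv fullv fullv.

Definition lie_center : {vspace L} :=
  (\bigcap_(j < \dim {:L}) lker (linfun (lie (vbasis {:L})`_j)))%VS.

(* lower_central k is the term usually numbered k + 1, the series
   starting with L at 1. *)
Fixpoint lower_central (k : nat) : {vspace L} :=
  if k is k'.+1 then lie_prodv (lower_central k') fullv else fullv.

Definition lie_abelian : Prop := forall x y : L, lie x y = 0.

Definition nilpotent_of_class (c : nat) : Prop :=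
  lower_central c = 0%VS /\
  (forall k : nat, (k < c)%N -> lower_central k != 0%VS).

Lemma lie0l (y : L) : lie 0 y = 0.
Proof.
have := lie_linear_l y 1 0 0; rewrite !scale1r addr0 => /eqP.
by rewrite -subr_eq0 opprD addrA subrr add0r oppr_eq0 => /eqP.
Qed.

Lemma lie_suml (y : L) k (a : 'I_k -> K) (v : 'I_k -> L) :
  lie (\sum_(j < k) a j *: v j) y = \sum_(j < k) a j *: lie (v j) y.
Proof.
elim: k a v => [|k IHk] a v; first by rewrite !big_ord0 lie0l.
by rewrite !big_ord_recl lie_linear_l IHk.
Qed.

Lemma lie_antisym (x y : L) : lie x y = - lie y x.
Proof.
have lieD u v w : lie (u + v) w = lie u w + lie v w :> L.
  by have := lie_linear_l w 1 u v; rewrite !scale1r.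
have := lie_alternating (x + y).
rewrite lieD !linearD /= !lie_alternating add0r addr0 => /eqP.
by rewrite addr_eq0 => /eqP.
Qed.

Lemma mem_lie_prodv (U V : {vspace L}) (u v : L) :
  u \in U -> v \in V -> lie u v \in lie_prodv U V.
Proof.
move=> Uu Vv; rewrite (coord_vbasis Uu) (coord_vbasis Vv) lie_suml.
apply: memv_suml => j _; apply: memvZ; rewrite linear_sum /=.
apply: memv_suml => l _; rewrite linearZ /=; apply: memvZ; apply: memv_span.
by apply: allpairs_f; apply: mem_nth; rewrite size_tuple.
Qed.

Lemma lie_prodv_sub (U V W : {vspace L}) :
  (lie_prodv U V <= W)%VS <->
  (forall u v : L, u \in U -> v \in V -> lie u v \in W).
Proof.
split=> [sUVW u v Uu Vv|UVW]; first exact: (subvP sUVW _ (mem_lie_prodv Uu Vv)).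
apply/span_subvP => _ /allpairsP[[u v] /= [Uu Vv ->]].
by apply: UVW; apply: vbasis_mem.
Qed.

Lemma mem_lie_center (z : L) :
  z \in lie_center <-> (forall y : L, lie z y = 0).
Proof.
split=> [|Zz].
  rewrite memvE => /subv_bigcapP Zz y.
  rewrite lie_antisym (coord_vbasis (memvf y)) lie_suml big1 ?oppr0 // => j _.
  have := Zz j isT; rewrite -memvE memv_ker lfunE /= => /eqP ->.
  by rewrite scaler0.
rewrite memvE; apply/subv_bigcapP => j _.
by rewrite -memvE memv_ker lfunE /= lie_antisym Zz oppr0.
Qed.

End FiniteDimensional.

(* A(k). *)
Definition abelian_lie (K : fieldType) (k : nat) : Type := 'rV[K]_k.

Section AbelianLie.
Variables (K : fieldType) (k : nat).
Local Notation A := (abelian_lie K k).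

HB.instance Definition _ := Vector.copy A 'rV[K]_k.

Definition abelian_bracket (x y : A) : A := 0.

Fact abelian_linear_l y : linear (fun x => abelian_bracket x y).
Proof. by move=> a u v; rewrite /abelian_bracket scaler0 addr0. Qed.
Fact abelian_linear_r x : linear (fun y => abelian_bracket x y).
Proof. by move=> a u v; rewrite /abelian_bracket scaler0 addr0. Qed.
Fact abelian_alternating x : abelian_bracket x x = 0.
Proof. by []. Qed.
Fact abelian_jacobi x y z :
  abelian_bracket x (abelian_bracket y z) +
  abelian_bracket y (abelian_bracket z x) +
  abelian_bracket z (abelian_bracket x y) = 0.
Proof. by rewrite /abelian_bracket !addr0. Qed.

HB.instance Definition _ := Lmodule_isLieAlgebra.Build K A
  abelian_linear_l abelian_linear_r abelian_alternating abelian_jacobi.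

End AbelianLie.

(* H(1), with x, y, z the standard basis vectors 0, 1, 2 of K^3. *)
Definition heisenberg (K : fieldType) : Type := 'rV[K]_3.

Section Heisenberg.
Variable K : fieldType.
Local Notation H := (heisenberg K).

HB.instance Definition _ := Vector.copy H 'rV[K]_3.

Definition hx : H := delta_mx 0 (inord 0).
Definition hy : H := delta_mx 0 (inord 1).
Definition hz : H := delta_mx 0 (inord 2).

Definition heisenberg_bracket (u v : H) : H :=
  ((u : 'rV[K]_3) 0 (inord 0) * (v : 'rV[K]_3) 0 (inord 1) -
   (u : 'rV[K]_3) 0 (inord 1) * (v : 'rV[K]_3) 0 (inord 0)) *: hz.

Fact heisenberg_linear_l v : linear (fun u => heisenberg_bracket u v).
Proof.
move=> a u w; rewrite /heisenberg_bracket !mxE scalerA -scalerDl.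
congr (_ *: _); rewrite !mulrDl !mulrBr !mulrA opprD.
by rewrite addrACA.
Qed.

Fact heisenberg_alternating u : heisenberg_bracket u u = 0.
Proof. by rewrite /heisenberg_bracket mulrC subrr scale0r. Qed.

Fact heisenberg_antisym u v : heisenberg_bracket u v = - heisenberg_bracket v u.
Proof.
rewrite /heisenberg_bracket -scaleNr opprB.
by congr ((_ - _) *: _); rewrite mulrC.
Qed.

Fact heisenberg_linear_r u : linear (fun v => heisenberg_bracket u v).
Proof.
move=> a v w; rewrite heisenberg_antisym heisenberg_linear_l opprD -scalerN.
by rewrite -!heisenberg_antisym.
Qed.

Fact heisenberg_nil2 u v w :
  heisenberg_bracket u (heisenberg_bracket v w) = 0.
Proof.
rewrite {1}/heisenberg_bracket /heisenberg_bracket !mxE /=.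
have -> : (inord 0 == inord 2 :> 'I_3) = false.
  by apply/negbTE; rewrite -val_eqE /= !inordK.
have -> : (inord 1 == inord 2 :> 'I_3) = false.
  by apply/negbTE; rewrite -val_eqE /= !inordK.
by rewrite !mulr0 subrr scale0r.
Qed.

Fact heisenberg_jacobi x y z :
  heisenberg_bracket x (heisenberg_bracket y z) +
  heisenberg_bracket y (heisenberg_bracket z x) +
  heisenberg_bracket z (heisenberg_bracket x y) = 0.
Proof. by rewrite !heisenberg_nil2 !addr0. Qed.

HB.instance Definition _ := Lmodule_isLieAlgebra.Build K H
  heisenberg_linear_l heisenberg_linear_r heisenberg_alternating
  heisenberg_jacobi.

Lemma heisenberg_relations :
  [/\ lie hx hy = hz, lie hx hz = 0 & lie hy hz = 0].
Proof.
rewrite /lie /= /heisenberg_bracket !mxE /= -!val_eqE /= !inordK //=.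
by rewrite !(mulr0, mul0r, mulr1, subr0, scale0r, scale1r).
Qed.

End Heisenberg.

(* Direct sums, as cartesian products with componentwise bracket. *)
Section DirectSum.
Variables (K : fieldType) (L M : lieAlgType K).

Definition prod_bracket (u v : L * M) : L * M := (lie u.1 v.1, lie u.2 v.2).

Fact prod_linear_l v : linear (fun u => prod_bracket u v).
Proof. by move=> a u w; congr pair; apply: lie_linear_l. Qed.
Fact prod_linear_r u : linear (fun v => prod_bracket u v).
Proof. by move=> a v w; congr pair; apply: lie_linear_r. Qed.
Fact prod_alternating u : prod_bracket u u = 0.
Proof. by rewrite /prod_bracket !lie_alternating. Qed.
Fact prod_jacobi u v w :
  prod_bracket u (prod_bracket v w) + prod_bracket v (prod_bracket w u) +
  prod_bracket w (prod_bracket u v) = 0.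
Proof. by congr pair; apply: lie_jacobi. Qed.

HB.instance Definition _ := Lmodule_isLieAlgebra.Build K (L * M)%type
  prod_linear_l prod_linear_r prod_alternating prod_jacobi.

End DirectSum.

(* Main.v *)
(* Write J for the subspace of L (x) L spanned by all x (x) x and all Jacobi
   elements x (x) [y, z] + y (x) [z, x] + z (x) [x, y]. A linear section of
   F -> L identifies F^2 / [R, F] with (L (x) L) / J, freeness of F being
   used only through the central extension of L by (L (x) L) / J; hence dim
   M(L) = n^2 - dim J - m. The codimension of J is bounded by following dim
   (J + V (x) L) along a chain of ideals V. Adjoining z to W with [z, L] <=
   W costs at most n - dim (L^2 + W + <z>), since z (x) [u, v] is already
   there. The chain starts with a complement of the intersection of Z(L) and
   L^2 in Z(L), goes on with a hyperplane U of L^2 containing [L^2, L], and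
   then adds w = [y, z] outside U, which costs only 2: up to y and z every x
   satisfies [x, y], [x, z] in U, and then x (x) w is already there; it ends
   with an arbitrary flag from there up to L. If m = 1 and the bound is
   attained, adding w is not free, which forces the common centraliser of y
   and z to be central. *)

Require Import Defs.
From HB Require Import structures.
From mathcomp Require Import all_boot all_order all_algebra.
From mathcomp Require Import boolp classical_sets.
From mathcomp Require Import zify ring lra.
Import Order.TTheory GRing.Theory Num.Theory.
Import VectorInternalTheory.
Local Open Scope ring_scope.

Set Implicit Arguments.
Unset Strict Implicit.
Unset Printing Implicit Defensive.

(** * Linear spans and finite generating sequences *)

Section LinearSpan.
Variables (K : fieldType) (V : lmodType K) (S : set V).

Lemma linear_span_mem v : S v -> linear_span S v.
Proof.
move=> Sv; exists 1%N, (fun=> 1), (fun=> v).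
by split=> //; rewrite big_ord1 scale1r.
Qed.

Lemma linear_spanD u v :
  linear_span S u -> linear_span S v -> linear_span S (u + v).
Proof.
move=> [k [a [s [Ss ->]]]] [l [b [r [Sr ->]]]].
exists (k + l)%N, (fun j => match split j with inl i => a i | inr i => b i end),
  (fun j => match split j with inl i => s i | inr i => r i end); split.
  by move=> j; case: (split j).
rewrite big_split_ord /=; congr (_ + _); apply: eq_bigr => j _.
  by rewrite (unsplitK (inl j)).
by rewrite (unsplitK (inr j)).
Qed.

Lemma linear_spanZ c v : linear_span S v -> linear_span S (c *: v).
Proof.
move=> [k [a [s [Ss ->]]]]; exists k, (fun j => c * a j), s; split=> //.
by rewrite scaler_sumr; apply: eq_bigr => j _; rewrite scalerA.
Qed.

Lemma linear_span_ind (Q : V -> Prop) :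
  (forall v, S v -> Q v) -> Q 0 -> (forall u v, Q u -> Q v -> Q (u + v)) ->
  (forall c v, Q v -> Q (c *: v)) -> forall v, linear_span S v -> Q v.
Proof.
move=> QS Q0 QD QZ v [k [a [s [Ss ->]]]].
by apply: (big_ind Q) => // j _; apply/QZ/QS.
Qed.

End LinearSpan.

Section FiniteSpan.
Variables (K : fieldType) (V : vectType K).

Lemma finite_generating_seq (S : set V) : exists s : seq V,
  (forall v, v \in s -> S v) /\ (forall v, S v -> v \in <<s>>%VS).
Proof.
(* Take a list of elements of S whose span has maximal dimension. *)
pose P k := `[< exists s : seq V,
  (forall v, v \in s -> S v) /\ \dim <<s>> = k >].
have exP : exists k, P k.
  by exists (\dim <<[::] : seq V>>); apply/asboolP; exists [::].
have ubP k : P k -> (k <= \dim {:V})%N.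
  by move/asboolP => [s [_ <-]]; apply/dimvS/subvf.
case: (ex_maxnP exP ubP) => k /asboolP [s [Ss ds]] kmax.
exists s; split=> // v Sv.
have sub : (<<s>> <= <<v :: s>>)%VS by rewrite span_cons addvSr.
have : (\dim <<v :: s>> <= k)%N.
  apply: kmax; apply/asboolP; exists (v :: s); split=> // u.
  by rewrite in_cons => /orP [/eqP ->|/Ss].
rewrite -ds => le.
have : (<<s>> == <<v :: s>>)%VS by rewrite eqEdim sub le.
by move/eqP ->; apply: memv_span; rewrite mem_head.
Qed.

End FiniteSpan.

Lemma linear_comb (K : fieldType) (U V : lmodType K) (f : U -> V) (lf : linear f)
    (I : Type) (r : seq I) (a : I -> K) (v : I -> U) :
  f (\sum_(i <- r) a i *: v i) = \sum_(i <- r) a i *: f (v i).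
Proof.
pose g : {linear U -> V} := HB.pack f (GRing.isLinear.Build K U V *:%R f lf).
rewrite -[f]/(g : U -> V) linear_sum; apply: eq_bigr => i _.
by rewrite linearZ.
Qed.

(** * The tensor square of L as a space of matrices *)

Section Tensor.
Variables (K : fieldType) (L : vectType K).

Notation T := 'M[K]_(dim L).

(** In coordinates a pure tensor is the rank-one matrix of the products [v2r x 0 i * v2r y 0 j]. *)
Definition tens (x y : L) : T := (v2r x)^T *m v2r y.

Definition stdv (i : 'I_(dim L)) : L := r2v (delta_mx 0 i).

Lemma tens_linear_l y : linear (tens ^~ y).
Proof. by move=> a u v; rewrite /tens !linearP /= mulmxDl scalemxAl. Qed.

Lemma tens_linear_r x : linear (tens x).
Proof. by move=> a u v; rewrite /tens linearP /= mulmxDr scalemxAr. Qed.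

Lemma stdv_sum x : x = \sum_i v2r x 0 i *: stdv i.
Proof.
rewrite -[LHS]v2rK {1}[v2r x]row_sum_delta linear_sum.
by apply: eq_bigr => i _; rewrite linearZ.
Qed.

Lemma tens_stdv i j : tens (stdv i) (stdv j) = delta_mx i j.
Proof. by rewrite /tens !r2vK trmx_delta mul_delta_mx. Qed.

(** The linear map that the universal property of the tensor square attaches to a bilinear [h]. *)
Definition tlift (V : lmodType K) (h : L -> L -> V) (A : T) : V :=
  \sum_i \sum_j A i j *: h (stdv i) (stdv j).

Lemma tlift_linear (V : lmodType K) (h : L -> L -> V) : linear (tlift h).
Proof.
move=> a A B; rewrite /tlift scaler_sumr -big_split; apply: eq_bigr => i _ /=.
rewrite scaler_sumr -big_split; apply: eq_bigr => j _ /=.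
by rewrite !mxE scalerDl scalerA.
Qed.

HB.instance Definition _ (V : lmodType K) (h : L -> L -> V) :=
  GRing.isLinear.Build K T V *:%R (tlift h) (tlift_linear h).

Lemma tliftE (V : lmodType K) (h : L -> L -> V) :
  (forall y, linear (h ^~ y)) -> (forall x, linear (h x)) ->
  forall x y, tlift h (tens x y) = h x y.
Proof.
move=> hl hr x y.
rewrite [in RHS](stdv_sum x) (linear_comb (hl y)); apply: eq_bigr => i _.
rewrite [in RHS](stdv_sum y) (linear_comb (hr _)) scaler_sumr.
apply: eq_bigr => j _.
by rewrite scalerA !mxE big_ord1 !mxE.
Qed.

Lemma tens_ext (V : lmodType K) (f g : {linear T -> V}) :
  (forall x y, f (tens x y) = g (tens x y)) -> f =1 g.
Proof.
move=> fg A; rewrite [A]matrix_sum_delta !linear_sum; apply: eq_bigr => i _.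
rewrite !linear_sum; apply: eq_bigr => j _.
by rewrite !linearZ /= -tens_stdv fg.
Qed.

End Tensor.

(** * The relators and the central extension built from them *)

Section Relators.
Variables (K : fieldType) (L : lieVectType K).

Local Notation T := 'M[K]_(dim L).

Definition jactens (x y z : L) : T :=
  tens x (lie y z) + tens y (lie z x) + tens z (lie x y).

Definition relator : set T := [set a |
  (exists x : L, a = tens x x) \/ (exists x y z : L, a = jactens x y z)].

(** [relator] may be an infinite set; a finite sequence with the same span yields a [{vspace T}],
    hence a dimension. *)
Definition relseq : seq T := projT1 (cid (finite_generating_seq relator)).

(** Modulo the tensors [tens x x], the elements [jactens x y z] are up to sign the
    Chevalley-Eilenberg boundaries, so the kernel of the bracket modulo [relv] is the second
    homology of L. *)
Definition relv : {vspace T} := <<relseq>>%VS.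

Lemma relseq_relator a : a \in relseq -> relator a.
Proof. by rewrite /relseq; case: cid => s /= [+ _]; apply. Qed.

Lemma relv_tens x : tens x x \in relv.
Proof.
rewrite /relv /relseq; case: cid => s /= [_]; apply.
by left; exists x.
Qed.

Lemma relv_jac x y z : jactens x y z \in relv.
Proof.
rewrite /relv /relseq; case: cid => s /= [_]; apply.
by right; exists x, y, z.
Qed.

Lemma relv_ind (Q : T -> Prop) :
  Q 0 -> (forall a b, Q a -> Q b -> Q (a + b)) ->
  (forall c a, Q a -> Q (c *: a)) ->
  (forall x, Q (tens x x)) -> (forall x y z, Q (jactens x y z)) ->
  forall a, a \in relv -> Q a.
Proof.
move=> Q0 QD QZ Qt Qj a Ra.
rewrite (coord_span (Ra : a \in <<in_tuple relseq>>%VS)).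
apply: (big_ind Q) => // i _; apply: QZ.
have : (in_tuple relseq)`_i \in relseq by rewrite mem_nth.
by move=> /relseq_relator [[x ->]|[x [y [z ->]]]].
Qed.

Lemma relv_sub (W : {vspace T}) :
  (forall x, tens x x \in W) -> (forall x y z, jactens x y z \in W) ->
  (relv <= W)%VS.
Proof.
move=> Wt Wj; apply/subvP; apply: relv_ind => //; first exact: mem0v.
  by move=> u v; apply: memvD.
by move=> c u; apply: memvZ.
Qed.

Lemma relv_tensC x y : tens x y + tens y x \in relv.
Proof.
have tl u v w : tens (u + v) w = tens u w + tens v w :> T.
  by have := tens_linear_l w 1 u v; rewrite !scale1r.
have tr u v w : tens w (u + v) = tens w u + tens w v :> T.
  by have := tens_linear_r w 1 u v; rewrite !scale1r.
have -> : tens x y + tens y x = tens (x + y) (x + y) - tens x x - tens y y.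
  rewrite tl !tr [_ - tens x x]addrAC [_ - tens x x]addrAC subrr add0r.
  by rewrite addrA addrK.
by rewrite !rpredB ?relv_tens.
Qed.

End Relators.

(* The central extension of L by (L \otimes L) / relv whose cocycle is the class
   of x \otimes y; the quotient is realised as a complement of relv. *)
Definition cover_lie (K : fieldType) (L : lieVectType K) : Type :=
  (L * 'M[K]_(dim L))%type.

Section CoverLie.
Variables (K : fieldType) (L : lieVectType K).

Local Notation T := 'M[K]_(dim L).
Local Notation E := (cover_lie L).

HB.instance Definition _ := GRing.Lmodule.copy E (L * T)%type.

Definition relproj (a : T) : T := a - projv (relv L) a.

Lemma relproj_linear : linear relproj.
Proof. by move=> c a b; rewrite /relproj linearP scalerBr opprD addrACA. Qed.

HB.instance Definition _ :=
  GRing.isLinear.Build K T T *:%R relproj relproj_linear.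

Lemma relproj_eq0 a : (relproj a == 0) = (a \in relv L).
Proof.
apply/eqP/idP => [/subr0_eq ->|Ra]; first exact: memv_proj.
by rewrite /relproj projv_id ?subrr.
Qed.

Definition cover_bracket (u v : E) : E :=
  (lie u.1 v.1, relproj (tens u.1 v.1)).

Fact cover_linear_l v : linear (fun u => cover_bracket u v).
Proof.
move=> a u w; congr pair; first exact: lie_linear_l.
by rewrite /= tens_linear_l linearP.
Qed.

Fact cover_linear_r u : linear (cover_bracket u).
Proof.
move=> a v w; congr pair; first exact: lie_linear_r.
by rewrite /= tens_linear_r linearP.
Qed.

Fact cover_alternating u : cover_bracket u u = 0.
Proof.
by congr pair; [exact: lie_alternating|apply/eqP; rewrite relproj_eq0 relv_tens].
Qed.

(** The second component is [relproj] of a Jacobi element [jactens], which lies in [relv]. *)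
Fact cover_jacobi u v w :
  cover_bracket u (cover_bracket v w) + cover_bracket v (cover_bracket w u) +
  cover_bracket w (cover_bracket u v) = 0.
Proof.
congr pair; first exact: lie_jacobi.
by apply/eqP; rewrite /= -!linearD /= relproj_eq0 relv_jac.
Qed.

HB.instance Definition _ := Lmodule_isLieAlgebra.Build K E
  cover_linear_l cover_linear_r cover_alternating cover_jacobi.

End CoverLie.

(** * Bracket identities, linear sections and the bracket as a map on tensors *)

Section LieAlgebraFacts.
Variables (K : fieldType) (F : lieAlgType K).
Implicit Types x y z : F.

Lemma lieDl x y z : lie (x + y) z = lie x z + lie y z.
Proof. by have := lie_linear_l z 1 x y; rewrite !scale1r. Qed.

Lemma lieBl x y z : lie (x - y) z = lie x z - lie y z.
Proof.
have := lie_linear_l z (-1) y x; rewrite !scaleN1r => lieBA.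
by rewrite [x - y]addrC lieBA addrC.
Qed.

Lemma lieC x y : lie x y = - lie y x.
Proof.
have := lie_alternating (x + y).
rewrite lieDl !linearD /= !lie_alternating add0r addr0 => /eqP.
by rewrite addr_eq0 => /eqP.
Qed.

Lemma lieZl a x y : lie (a *: x) y = a *: lie x y.
Proof. by rewrite lieC linearZ -scalerN -lieC. Qed.

End LieAlgebraFacts.

Lemma linear_section (K : fieldType) (L : vectType K) (F : lmodType K)
    (p : {linear F -> L}) : (forall y, exists x, p x = y) ->
  exists s : L -> F, linear s /\ forall x, p (s x) = x.
Proof.
move=> psurj; have [w pw] := choice (fun i : 'I_(dim L) => psurj (stdv i)).
exists (fun x => \sum_i v2r x 0 i *: w i); split=> [a x y|x].
  rewrite scaler_sumr -big_split; apply: eq_bigr => i _ /=.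
  by rewrite linearP !mxE scalerDl scalerA.
rewrite linear_sum [RHS]stdv_sum; apply: eq_bigr => i _.
by rewrite linearZ /= pw.
Qed.

Section BracketMap.
Variables (K : fieldType) (L : lieVectType K).

Local Notation T := 'M[K]_(dim L).

Definition bracket_map : 'Hom(T, L) := linfun (tlift (@lie K L)).

Lemma bracket_mapE x y : bracket_map (tens x y) = lie x y.
Proof.
by rewrite lfunE /= tliftE //; [apply: lie_linear_l|apply: lie_linear_r].
Qed.

Lemma limg_bracket_map : limg bracket_map = lie_derived L.
Proof.
apply/eqP; rewrite eqEsubv; apply/andP; split.
  apply/subvP => _ /memv_imgP [a _ ->]; rewrite lfunE /=.
  apply: memv_suml => i _; apply: memv_suml => j _; apply: memvZ.
  by apply: mem_lie_prodv; apply: memvf.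
apply/lie_prodv_sub => u v _ _.
by rewrite -bracket_mapE memv_img ?memvf.
Qed.

Lemma relv_sub_ker : (relv L <= lker bracket_map)%VS.
Proof.
apply: relv_sub => [x|x y z]; rewrite memv_ker ?linearD /= !bracket_mapE.
  by rewrite lie_alternating.
by rewrite lie_jacobi.
Qed.

Lemma dim_ker_bracket_map :
  (\dim (lker bracket_map) + \dim (lie_derived L) = dim L * dim L)%N.
Proof.
have := limg_ker_dim bracket_map fullv.
by rewrite limg_bracket_map capfv dimvf dim_matrix.
Qed.

End BracketMap.

(** * The multiplier as the kernel of the bracket modulo relators *)

Section SchurMultiplier.
Variables (K : fieldType) (L : lieVectType K) (X : Type) (F : lieAlgType K).
Variables (i : X -> F) (p : {linear F -> L}).
Hypothesis hF : free_presentation i p.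

Local Notation T := 'M[K]_(dim L).
Local Notation R := (lie_kernel p).
Local Notation RF := (lie_prod R setT).
Local Notation F2 := (lie_prod (@setT F) setT).

Lemma lie_prod_kernel_l r x : p r = 0 -> RF (lie r x).
Proof. by move=> pr; apply: linear_span_mem; exists r, x. Qed.

Lemma lie_prod_kernel_r r x : p r = 0 -> RF (lie x r).
Proof.
move=> pr; rewrite lieC -scaleN1r.
by apply: linear_spanZ; apply: lie_prod_kernel_l.
Qed.

Lemma lie_prod0 (A B : set F) : lie_prod A B 0.
Proof. by exists 0%N, (fun=> 0), (fun=> 0); split; [case|rewrite big_ord0]. Qed.

Section LiftedBracket.
Variables (s : L -> F) (ls : linear s) (ps : forall x, p (s x) = x).

(** This map induces the isomorphism from [T] modulo [relv L] to F^2 / [R, F]; the lemmas below show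
    that it is well defined, onto and injective. *)
Definition lifted_bracket : T -> F := tlift (fun x y => lie (s x) (s y)).

HB.instance Definition _ :=
  GRing.Linear.copy lifted_bracket (tlift (fun x y => lie (s x) (s y))).

Lemma lifted_bracketE x y : lifted_bracket (tens x y) = lie (s x) (s y).
Proof.
rewrite [LHS]tliftE // => [{}y|{}x] a u v; rewrite ls.
  exact: lie_linear_l.
exact: lie_linear_r.
Qed.

Let p_morph : lie_morphism p. Proof. by case: hF. Qed.

Lemma p_lifted_bracket a : p (lifted_bracket a) = bracket_map L a.
Proof.
apply: (@tens_ext _ _ _ (p \o lifted_bracket) (bracket_map L)) => x y /=.
by rewrite lifted_bracketE p_morph !ps bracket_mapE.
Qed.

Lemma lifted_bracket_derived a : F2 (lifted_bracket a).
Proof.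
rewrite /lifted_bracket /tlift.
apply: (big_ind F2) => [||k _]; [exact: lie_prod0|exact: linear_spanD|].
apply: (big_ind F2) => [||l _]; [exact: lie_prod0|exact: linear_spanD|].
by apply/linear_spanZ/linear_span_mem; exists (s (stdv k)), (s (stdv l)).
Qed.

(** A section need not preserve brackets, but [s (lie v w)] and [lie (s v) (s w)] differ by an
    element of R. Modulo [R, F] a Jacobi element therefore goes to a Jacobi sum in F, which is 0. *)
Lemma lifted_bracket_relv a : a \in relv L -> RF (lifted_bracket a).
Proof.
move: a; apply: (relv_ind (Q := fun a => RF (lifted_bracket a))).
- by rewrite linear0; apply: lie_prod0.
- by move=> a b Ra Rb; rewrite linearD; apply: linear_spanD.
- by move=> c a Ra; rewrite linearZ; apply: linear_spanZ.
- by move=> x; rewrite lifted_bracketE lie_alternating; apply: lie_prod0.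
move=> x y z; rewrite !linearD /= !lifted_bracketE.
have sR u v w : RF (lie (s u) (s (lie v w)) - lie (s u) (lie (s v) (s w))).
  rewrite -linearB; apply: lie_prod_kernel_r.
  by rewrite linearB /= p_morph !ps subrr.
(* The Jacobi sum in F, being 0, is subtracted so that the three differences of [sR] appear. *)
rewrite -[X in RF X]subr0 -(lie_jacobi (s x) (s y) (s z)) !opprD.
rewrite addrACA [X in X + _]addrACA.
by apply: linear_spanD; [apply: linear_spanD|]; apply: sR.
Qed.

Lemma lifted_bracket_surj x : F2 x -> exists a, RF (x - lifted_bracket a).
Proof.
move: x; apply: linear_span_ind.
- move=> _ [u [v [_ _ ->]]]; exists (tens (p u) (p v)).
  rewrite lifted_bracketE.
  (* Both arguments are moved to their images under [s] one at a time, with [lie (s (p u)) v] in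
     between. *)
  rewrite -[X in X - _](subrK (lie (s (p u)) v)) -addrA -lieBl -linearB.
  apply: linear_spanD; [apply: lie_prod_kernel_l|apply: lie_prod_kernel_r].
    by rewrite linearB /= ps subrr.
  by rewrite linearB /= ps subrr.
- by exists 0; rewrite linear0 subr0; apply: lie_prod0.
- move=> u v [a Ra] [b Rb]; exists (a + b).
  by rewrite linearD opprD addrACA; apply: linear_spanD.
- move=> c v [a Ra]; exists (c *: a).
  by rewrite linearZ -scalerBr; apply: linear_spanZ.
Qed.

(** Freeness sends each generator [i x] to [(p (i x), 0)]. The first component of the resulting
    morphism agrees with [p] on generators, hence everywhere by uniqueness. *)
Lemma cover_lift : exists f : {linear F -> cover_lie L},
  lie_morphism f /\ forall x, (f x).1 = p x.
Proof.
case: hF => hfree _ _.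
have [f [fm fi _]] := hfree (cover_lie L) (fun x => (p (i x), 0)).
exists f; split=> //.
have l1 : linear (fun x => (f x).1) by move=> a u v; rewrite linearP.
pose f1 : {linear F -> L} := HB.pack (fun x => (f x).1)
  (GRing.isLinear.Build K F L *:%R _ l1).
have [g [_ _ guniq]] := hfree L (fun x => p (i x)).
move=> x; rewrite -[LHS]/(f1 x) (guniq f1) -?(guniq p) //.
- by move=> u v; rewrite /= fm.
- by move=> u; rewrite /= fi.
Qed.

(** The second component [f2] of the lift to the cover depends on a bracket only through [p], so it
    kills [R, F]; composed with [lifted_bracket] it is [relproj], whose kernel is [relv L]. *)
Lemma lifted_bracket_kernel a : RF (lifted_bracket a) -> a \in relv L.
Proof.
have [f [fm fp]] := cover_lift.
have l2 : linear (fun x => (f x).2) by move=> c u v; rewrite linearP.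
pose f2 : {linear F -> T} := HB.pack (fun x => (f x).2)
  (GRing.isLinear.Build K F T *:%R _ l2).
have f2lie u v : f2 (lie u v) = relproj (tens (p u) (p v)).
  by rewrite /= fm /= !fp.
have f2R x : RF x -> f2 x = 0.
  move: x; apply: linear_span_ind.
  - move=> _ [r [v [Rr _ ->]]]; rewrite f2lie Rr.
    by rewrite /tens linear0 trmx0 mul0mx linear0.
  - exact: linear0.
  - by move=> u v fu fv; rewrite linearD fu fv addr0.
  - by move=> c v fv; rewrite linearZ_LR fv scaler0.
move=> /f2R; rewrite -relproj_eq0 => <-; apply/eqP.
symmetry; move: a; apply: (@tens_ext _ _ _ (f2 \o lifted_bracket) (@relproj K L)).
move=> x y; rewrite -[LHS]/(f2 (lifted_bracket (tens x y))).
by rewrite lifted_bracketE f2lie !ps.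
Qed.

End LiftedBracket.

Theorem schur_multiplier_dimE :
  schur_multiplier_dim p (\dim (lker (bracket_map L)) - \dim (relv L)).
Proof.
have psurj : forall y, exists x, p x = y by case: hF.
have [s [ls ps]] := linear_section psurj.
pose U : {linear T -> F} := lifted_bracket s.
pose N := lker (bracket_map L); pose J := relv L.
have dC : \dim (N :\: J) = (\dim N - \dim J)%N.
  have := dimv_cap_compl N J; rewrite (capv_idPr (relv_sub_ker L)) => <-.
  by rewrite addKn.
rewrite /schur_multiplier_dim -dC.
(* A basis of a complement of [J] in [N] is carried over by [U]. *)
exists (fun j => U (vbasis (N :\: J))`_j); split.
- move=> j; split; last exact: lifted_bracket_derived.
  have : (vbasis (N :\: J))`_j \in N.
    apply: (subvP (diffvSl N J)); apply: vbasis_mem.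
    by rewrite mem_nth ?size_tuple.
  by rewrite memv_ker /lie_kernel /= p_lifted_bracket // => /eqP.
- move=> a; set b := \sum_(j < _) a j *: (vbasis (N :\: J))`_j.
  have -> : \sum_(j < _) a j *: U (vbasis (N :\: J))`_j = U b.
    by rewrite /b linear_sum; apply: eq_bigr => j _; rewrite linearZ.
  move=> /(lifted_bracket_kernel ls ps) Jb.
  have : b \in ((N :\: J) :&: J)%VS.
    rewrite memv_cap Jb andbT; apply: memv_suml => j _; apply: memvZ.
    by apply: vbasis_mem; rewrite mem_nth ?size_tuple.
  rewrite capv_diff memv0 => /eqP b0.
  have /freeP := basis_free (vbasisP (N :\: J)); apply.
  exact: b0.
- move=> x [Rx /(lifted_bracket_surj ls ps) [a Ra]].
  (* [p] kills [R, F] and [x], so [bracket_map L a = p (U a) = 0]. *)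
  have Na : a \in N.
    rewrite memv_ker -(p_lifted_bracket ls ps) -/U.
    have : p (x - U a) = 0.
      move: (x - U a) Ra; apply: linear_span_ind.
      + move=> _ [r [v [Rr _ ->]]]; case: hF => _ pm _.
        by rewrite pm Rr lie0l.
      + exact: linear0.
      + by move=> u v fu fv; rewrite linearD fu fv addr0.
      + by move=> c v fv; rewrite linearZ_LR fv scaler0.
    by rewrite linearB Rx sub0r => /eqP; rewrite oppr_eq0.
  move: Na; rewrite -{1}(addv_diff_cap N J) => /memv_addP [c Cc [j]].
  rewrite memv_cap => /andP [_ Jj] ac.
  exists (fun k => coord (vbasis (N :\: J)) k c).
  have -> : \sum_(k < _) coord (vbasis (N :\: J)) k c *: U (vbasis (N :\: J))`_k
      = U c.
    rewrite [in RHS](coord_vbasis Cc) linear_sum.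
    by apply: eq_bigr => k _; rewrite linearZ.
  have -> : x - U c = (x - U a) + U j.
    by rewrite ac linearD opprD addrA subrK.
  by apply: linear_spanD => //; apply: lifted_bracket_relv.
Qed.

End SchurMultiplier.

HB.instance Definition _ (K : fieldType) (L : vectType K) (x : L) :=
  GRing.isLinear.Build K L 'M[K]_(dim L) *:%R (tens x) (tens_linear_r x).

(** * Cost of enlarging V in [reltens V] *)

Lemma hyperplane_above (K : fieldType) (V : vectType K) (A B : {vspace V}) :
  (A <= B)%VS -> A != B ->
  exists (C : {vspace V}) (z : V),
    [/\ (A <= C)%VS, B = (C + <[z]>)%VS & \dim B = (\dim C).+1].
Proof.
move=> sAB neAB.
have /subvPn [z Bz nAz] : ~~ (B <= A)%VS.
  by apply: contra neAB => sBA; rewrite eqEsubv sAB.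
(* [C] adds to [A] a complement of [A'] in [B], which leaves exactly the direction [z] missing. *)
pose A' := (A + <[z]>)%VS; pose C := (A + (B :\: A'))%VS.
have sA'B : (A' <= B)%VS by rewrite subv_add sAB -memvE.
have CB : B = (C + <[z]>)%VS.
  rewrite /C -addvA [(_ + <[z]>)%VS]addvC addvA -/A' addvC addv_diff.
  by apply/esym/addv_idPl.
exists C, z; split=> //; first exact: addvSl.
have dA' : (\dim A < \dim A')%N.
  rewrite ltnNge; apply: contra nAz => dle; rewrite memvE.
  have /eqP -> : A == A' by rewrite eqEdim addvSl.
  exact: addvSr.
have dC := (dimv_add_leqif A (B :\: A')).1; rewrite -/C in dC.
have := dimv_cap_compl B A'; rewrite (capv_idPr sA'B) => dB.
have := (dimv_add_leqif C <[z]>).1; rewrite -CB dim_vline.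
by case: (z != 0) => /= dB'; apply/eqP; lia.
Qed.

Section RelTensor.
Variables (K : fieldType) (L : lieVectType K).

Local Notation T := 'M[K]_(dim L).
Local Notation D := (lie_derived L).
Implicit Types U V W : {vspace L}.

(* The image of V \otimes L in (L \otimes L) / relv, pulled back. *)
Definition reltens V : {vspace T} :=
  (relv L + \sum_(u <- vbasis V) linfun (tens u) @: fullv)%VS.

Lemma tensDl (x y z : L) : tens (x + y) z = tens x z + tens y z.
Proof. by have := tens_linear_l z 1 x y; rewrite !scale1r. Qed.

Lemma tensZl a (x z : L) : tens (a *: x) z = a *: tens x z.
Proof.
have := tens_linear_l z a x 0; rewrite addr0 => ->.
by rewrite /tens linear0 trmx0 mul0mx addr0.
Qed.

Lemma mem_reltens V u v : u \in V -> tens u v \in reltens V.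
Proof.
move=> Vu; rewrite (coord_vbasis Vu) (linear_comb (tens_linear_l v)).
apply: memv_suml => j _; apply: memvZ; apply: (subvP (addvSr _ _)).
have -> : tens (vbasis V)`_j v = linfun (tens (vbasis V)`_j) v by rewrite lfunE.
rewrite memvE (big_nth 0) big_mkord.
have lt : (j < size (vbasis V))%N by rewrite size_tuple.
apply: (sumv_sup (Ordinal lt)) => //=.
by rewrite -memvE memv_img ?memvf.
Qed.

Lemma relv_sub_reltens V : (relv L <= reltens V)%VS.
Proof. exact: addvSl. Qed.

Lemma mem_reltens_r V u v : u \in V -> tens v u \in reltens V.
Proof.
move=> Vu; rewrite -[tens v u](addrK (tens u v)).
apply: memvB; last exact: mem_reltens.
by apply: (subvP (relv_sub_reltens V)); apply: relv_tensC.
Qed.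

Lemma reltens_sub V (A : {vspace T}) : (relv L <= A)%VS ->
  (forall u v, u \in V -> tens u v \in A) -> (reltens V <= A)%VS.
Proof.
move=> sJA VA; rewrite subv_add sJA /= (big_nth 0) big_mkord.
apply/subv_sumP => k _; apply/subvP => _ /memv_imgP [v _ ->].
by rewrite lfunE; apply/VA/vbasis_mem/mem_nth.
Qed.

Lemma reltens0 : reltens 0 = relv L.
Proof.
apply/eqP; rewrite eqEsubv relv_sub_reltens andbT; apply: reltens_sub => // u v.
by rewrite memv0 => /eqP ->; rewrite /tens linear0 trmx0 mul0mx mem0v.
Qed.

Lemma dim_reltensf : \dim (reltens fullv) = (\dim {:L} * \dim {:L})%N.
Proof.
have -> : reltens fullv = fullv.
  apply/eqP; rewrite eqEsubv subvf /=; apply/subvP => a _.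
  rewrite [a]matrix_sum_delta; apply: memv_suml => i _; apply: memv_suml => j _.
  by rewrite -tens_stdv; apply/memvZ/mem_reltens/memvf.
by rewrite !dimvf dim_matrix.
Qed.

Lemma dim_reltens_step W z : (forall v, lie z v \in W) ->
  (\dim (reltens (W + <[z]>)) + \dim (D + (W + <[z]>)) <=
   \dim (reltens W) + \dim {:L})%N.
Proof.
move=> zW; set V := (W + <[z]>)%VS; set S := (D + V)%VS.
pose tz : 'Hom(L, T) := linfun (tens z).
(* For v in [S] the tensor of z with v is already present: for brackets by the Jacobi relator, since
   [v, z] and [z, u] lie in [W]; for elements of [W] by antisymmetry; for z itself because
   [tens z z] is a relator. *)
have sS : (S <= tz @^-1: reltens W)%VS.
  rewrite subv_add; apply/andP; split.
    apply/lie_prodv_sub => u v _ _; rewrite -memv_preim lfunE /=.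
    have := subvP (relv_sub_reltens W) _ (relv_jac z u v); rewrite /jactens.
    rewrite -addrA => RJ.
    rewrite -[tens _ _](addrK (tens u (lie v z) + tens v (lie z u))).
    apply: memvB => //; apply: memvD; apply: mem_reltens_r => //.
    by rewrite lieC memvN.
  rewrite subv_add; apply/andP; split; apply/subvP => v.
    by move=> Wv; rewrite -memv_preim lfunE; apply: mem_reltens_r.
  move/vlineP => [k ->]; rewrite -memv_preim linearZ; apply/memvZ; rewrite /= lfunE.
  by apply: (subvP (relv_sub_reltens W)); apply: relv_tens.
(* Hence only the tensors of z with a complement of [S] are new. *)
have sV : (reltens V <= reltens W + tz @: S^C)%VS.
  apply: reltens_sub => [|_ v /memv_addP [u Wu [_ /vlineP [k ->] ->]]].
    by rewrite (subv_trans (relv_sub_reltens W)) ?addvSl.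
  rewrite tensDl tensZl; apply: memvD.
    by apply: (subvP (addvSl _ _)); apply: mem_reltens.
  apply: memvZ; have := memvf v; rewrite -(addv_complf S).
  move=> /memv_addP [s Ss [q Sq ->]]; rewrite linearD; apply: memv_add.
    by have := subvP sS _ Ss; rewrite -memv_preim lfunE.
  by apply/memv_imgP; exists q; rewrite ?lfunE.
have := dimvS sV.
have : (\dim (reltens W + tz @: S^C) <= \dim (reltens W) + \dim S^C)%N.
  apply: leq_trans (dimv_add_leqif _ _).1 _.
  by rewrite leq_add2l -(limg_ker_dim tz S^C) leq_addl.
by have := dimv_compl S; have := dimvS (subvf S); lia.
Qed.

(** Going down a flag from [V], the top step costs at most [e], the next [e + 1], and so on. The
    total k e + k (k - 1) / 2 is doubled and rearranged to avoid halves and truncated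
    subtraction. *)
Lemma dim_reltens_chain W V r e : (W <= V)%VS ->
  (forall v x, v \in V -> lie v x \in W) ->
  (forall A : {vspace L}, (W <= A <= V)%VS -> r + \dim A <= \dim (D + A))%N ->
  (\dim {:L} <= r + \dim V + e)%N ->
  let k := (\dim V - \dim W)%N in
  (2 * \dim (reltens V) + k <= 2 * \dim (reltens W) + k * k + 2 * k * e)%N.
Proof.
move=> sWV VW hr hn /=; move Ek : (\dim V - \dim W)%N => k.
elim: k V e Ek sWV VW hr hn => [|k IHk] V e Ek sWV VW hr hn.
  have := dimvS sWV => dWV.
  have -> : V = W; last by lia.
  by apply/esym/eqP; rewrite eqEdim sWV; lia.
have neWV : W != V.
  by apply/eqP => eWV; move: Ek; rewrite eWV subnn.
have [V' [z [sWV' EV dV]]] := hyperplane_above sWV neWV.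
have sV'V : (V' <= V)%VS by rewrite EV addvSl.
have zV : z \in V by rewrite EV (subvP (addvSr _ _)) ?memv_line.
have /IHk : (\dim V' - \dim W)%N = k by lia.
move=> /(_ (e.+1) sWV') IH.
have {}IH := IH _ _ _; have {IH} :
    (2 * \dim (reltens V') + k <= 2 * \dim (reltens W) + k * k + 2 * k * e.+1)%N.
  apply: IH => [v x V'v|A /andP [sWA sAV']|].
  - by apply: VW; apply: (subvP sV'V).
  - by apply: hr; rewrite sWA (subv_trans sAV').
  - by rewrite dV in hn; lia.
have := @dim_reltens_step V' z (fun v => subvP sWV' _ (VW z v zV)).
rewrite -EV; have := hr V; rewrite sWV subvv => /(_ isT).
by nia.
Qed.

Lemma reltens_hyperplane_derived U W y z :
  (U <= W)%VS -> (D <= U + <[lie y z]>)%VS ->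
  (reltens (W + <[lie y z]>) <=
   reltens W + <[tens (lie y z) y]> + <[tens (lie y z) z]>)%VS.
Proof.
move=> sUW sD; set w := lie y z.
have decomp u v : exists a, lie u v - a *: w \in U.
  have := subvP sD _ (mem_lie_prodv (memvf u) (memvf v)).
  move=> /memv_addP [s Us [_ /vlineP [a ->] ->]]; exists a.
  by rewrite addrK.
apply: reltens_sub => [|_ x /memv_addP [u Wu [_ /vlineP [k ->] ->]]].
  by rewrite -addvA (subv_trans (relv_sub_reltens W)) ?addvSl.
rewrite tensDl tensZl; apply: memvD.
  by rewrite -addvA (subvP (addvSl _ _)) ?mem_reltens.
apply: memvZ; have [a Ua] := decomp x y; have [b Ub] := decomp x z.
(* [s] corrects [x] so that [s, y] and [s, z] fall in [U]. The Jacobi relator of s, y, z then puts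
   the tensor of s and w in [reltens W], leaving only multiples of [tens w y] and [tens w z]. *)
pose s := x + a *: z - b *: y.
have sy : lie s y \in U.
  rewrite lieBl lieDl !lieZl lie_alternating scaler0 subr0.
  by rewrite [lie z y]lieC scalerN.
have sz : lie s z \in U.
  by rewrite lieBl lieDl !lieZl lie_alternating scaler0 addr0.
have ws : tens w s \in reltens W.
  rewrite -[tens w s](addrK (tens s w)) [_ + tens s w]addrC.
  apply: memvB; first exact: (subvP (relv_sub_reltens W) _ (relv_tensC _ _)).
  have := subvP (relv_sub_reltens W) _ (relv_jac s y z); rewrite /jactens.
  rewrite -addrA => RJ.
  rewrite -[tens s w](addrK (tens y (lie z s) + tens z (lie s y))).
  apply: memvB => //; apply: memvD; apply: mem_reltens_r; apply: (subvP sUW) => //.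
  by rewrite lieC memvN.
have -> : tens w x = tens w s + b *: tens w y + (- a) *: tens w z.
  by rewrite -!linearZ -!linearD /= /s subrK scaleNr addrK.
apply: memv_add; [apply: memv_add => //|]; apply: memvZ; exact: memv_line.
Qed.

End RelTensor.

(** * The chain of ideals in a nilpotent algebra *)

Section NilpotentBound.
Variables (K : fieldType) (L : lieVectType K) (c : nat).
Hypothesis nilL : lower_central L c = 0%VS.

Local Notation D := (lie_derived L).
Implicit Types U V W : {vspace L}.

(** If [V] were contained in [V, L], it would by induction lie in every term of the lower central
    series, hence in 0. *)
Lemma nilpotent_ideal_proper V : V != 0%VS -> ~~ (V <= lie_prodv V fullv)%VS.
Proof.
apply: contraNN => sV; rewrite -subv0 -nilL.
elim: c => [|k IHk] /=; first exact: subvf.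
apply: subv_trans sV _; apply/lie_prodv_sub => u v Vu _.
by apply: mem_lie_prodv; rewrite ?memvf // (subvP IHk).
Qed.

(** A subspace between [V, L] and [V] is again an ideal, so the construction can be iterated down to
    0. *)
Lemma nilpotent_ideal_hyperplane V :
  V != 0%VS -> (lie_prodv V fullv <= V)%VS ->
  exists (U : {vspace L}) (z : L),
    [/\ (lie_prodv V fullv <= U)%VS, V = (U + <[z]>)%VS & \dim V = (\dim U).+1].
Proof.
move=> V0 sV; apply: hyperplane_above => //.
by apply: contra (nilpotent_ideal_proper V0) => /eqP ->.
Qed.

(** [V] is reached through ideals of increasing dimension, and since each sum contains [D + A],
    every step costs at most [r]. *)
Lemma dim_reltens_ideal (A V : {vspace L}) r :
  (A <= lie_center L)%VS -> (lie_prodv V fullv <= V)%VS ->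
  (\dim {:L} <= \dim (D + A) + r)%N ->
  (\dim (reltens (A + V)) <= \dim (reltens A) + \dim V * r)%N.
Proof.
move=> Ac + hr; move EV : (\dim V) => k.
elim: k V EV => [|k IHk] V EV sV.
  by move/eqP: EV; rewrite dimv_eq0 => /eqP ->; rewrite addv0 addn0.
have V0 : V != 0%VS by rewrite -dimv_eq0 EV.
have [U [z [sU EVz dV]]] := nilpotent_ideal_hyperplane V0 sV.
have sUV : (U <= V)%VS by rewrite EVz addvSl.
have zV : z \in V by rewrite EVz (subvP (addvSr _ _)) ?memv_line.
have /IHk IH : \dim U = k by lia.
have {}/IH IH : (lie_prodv U fullv <= U)%VS.
  apply: subv_trans sU; apply/lie_prodv_sub => u v Uu _.
  by apply: mem_lie_prodv; rewrite ?memvf // (subvP sUV).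
have zAU v : lie z v \in (A + U)%VS.
  apply: (subvP (addvSr _ _)); apply: (subvP sU).
  by apply: mem_lie_prodv; rewrite ?memvf.
have := dim_reltens_step zAU; rewrite -addvA -EVz.
have : (\dim (D + A) <= \dim (D + (A + V)))%N.
  by apply/dimvS/addvS; rewrite ?addvSl.
by nia.
Qed.

(** Every subspace above [D] is an ideal, so any flag serves; from the top down its steps cost 0, 1,
    2 and so on. *)
Lemma dim_reltens_top W : (D <= W)%VS ->
  (2 * (\dim {:L} * \dim {:L}) + (\dim {:L} - \dim W) <=
   2 * \dim (reltens W) + (\dim {:L} - \dim W) * (\dim {:L} - \dim W))%N.
Proof.
move=> sDW; rewrite -dim_reltensf.
have := @dim_reltens_chain _ _ W fullv 0 0 (subvf W).
have DW v x : v \in fullv -> lie v x \in W.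
  by move=> _; apply: (subvP sDW); apply: mem_lie_prodv; apply: memvf.
have hA A : (W <= A <= fullv)%VS -> (0 + \dim A <= \dim (D + A))%N.
  by move=> _; apply/dimvS/addvSr.
move=> /(_ DW hA); rewrite add0n addn0 leqnn => /(_ isT) /=; lia.
Qed.

(** Brackets span [D], so one of them lies outside the hyperplane [U] and can replace the
    complementing vector. *)
Lemma derived_generator : ~ lie_abelian L ->
  exists (U : {vspace L}) (y z : L),
    [/\ (lie_prodv D fullv <= U)%VS, D = (U + <[lie y z]>)%VS
      & \dim D = (\dim U).+1].
Proof.
move=> nab; have D0 : D != 0%VS.
  apply/negP => /eqP D0; apply: nab => x y; apply/eqP.
  by rewrite -memv0 -D0; apply: mem_lie_prodv; apply: memvf.
have [|U [z0 [sU ED dD]]] := nilpotent_ideal_hyperplane D0.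
  by apply/lie_prodv_sub => u v _ _; apply: mem_lie_prodv; apply: memvf.
have [y [z nU]] : exists y z, lie y z \notin U.
  apply: contrapT => allU.
  suff : (D <= U)%VS by move/dimvS; rewrite dD ltnn.
  apply/lie_prodv_sub => u v _ _; apply: contrapT => /negP nU.
  by apply: allU; exists u, v.
exists U, y, z; split=> //.
have sUD : (U <= D)%VS by rewrite ED addvSl.
apply/esym/eqP; rewrite eqEdim; apply/andP; split.
  rewrite subv_add sUD -memvE; apply: mem_lie_prodv; exact: memvf.
rewrite dD ltnNge; apply: contra nU => dle; rewrite memvE.
have /eqP -> : U == (U + <[lie y z]>)%VS by rewrite eqEdim addvSl.
exact: addvSr.
Qed.

(* The chain is 0 <= A <= A + U <= A + D <= L, with U a hyperplane of D. *)
Lemma dim_relv_bound (A : {vspace L}) r : ~ lie_abelian L ->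
  (A <= lie_center L)%VS -> (A :&: D = 0)%VS ->
  (\dim {:L} = \dim D + \dim A + r)%N ->
  (2 * (\dim {:L} * \dim {:L}) + r + \dim A <=
   2 * \dim (relv L) + \dim A * \dim A + 2 * \dim A * r
   + 2 * (\dim D).-1 * r + 4 + r * r)%N.
Proof.
move=> nab Ac AD0 En; have [U [y [z [sU ED dD]]]] := derived_generator nab.
have dDA (B : {vspace L}) : (B <= A)%VS -> (\dim D + \dim B = \dim (D + B))%N.
  move=> sBA; rewrite dimv_disjoint_sum //; apply/eqP.
  by rewrite -subv0 -AD0 capvC capvS.
(* Below [A] the sums with [D] are direct, so the top step costs [r] and lower ones r + 1, r + 2 and
   so on. *)
have h1 : (2 * \dim (reltens A) + \dim A <=
    2 * \dim (relv L) + \dim A * \dim A + 2 * \dim A * r)%N.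
  have := @dim_reltens_chain _ _ 0%VS A (\dim D) r (sub0v A).
  rewrite reltens0 dimv0 subn0; apply.
  - move=> v x Av; have /mem_lie_center -> := subvP Ac _ Av.
    exact: mem0v.
  - by move=> B /andP [_ /dDA ->].
  - by rewrite En.
have h2 : (\dim (reltens (A + U)) <= \dim (reltens A) + \dim U * r)%N.
  apply: dim_reltens_ideal => //.
    apply: subv_trans sU; apply/lie_prodv_sub => u v Uu _.
    by apply: mem_lie_prodv; rewrite ?memvf // ED (subvP (addvSl _ _)).
  by rewrite En (dDA A).
(* The two extra tensors account for the constant 4 in the doubled bound. *)
have h3 : (\dim (reltens (A + D)) <= \dim (reltens (A + U)) + 2)%N.
  have EAD : (A + D = (A + U) + <[lie y z]>)%VS by rewrite ED addvA.
  have sDU : (D <= U + <[lie y z]>)%VS by rewrite -ED.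
  have := dimvS (reltens_hyperplane_derived (addvSr A U) sDU).
  rewrite -EAD => /leq_trans; apply.
  apply: leq_trans (dimv_add_leqif _ _).1 _; rewrite dim_vline.
  have -> : 2%N = (1 + 1)%N by []; rewrite addnA leq_add ?leq_b1 //.
  apply: leq_trans (dimv_add_leqif _ _).1 _; rewrite dim_vline.
  by rewrite leq_add2l leq_b1.
have h4 := dim_reltens_top (addvSr A D).
have dAD : \dim (A + D) = (\dim D + \dim A)%N by rewrite addvC dDA.
rewrite dAD En addKn -En in h4.
by rewrite dD /=; nia.
Qed.

End NilpotentBound.

(** * Splitting an algebra as H(1) plus an abelian summand *)

(** [k] is kept apart from [\dim C] so that coordinates live in [abelian_lie K k]. *)
Lemma vbasis_comb_free (K : fieldType) (V : vectType K) (C : {vspace V}) k :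
  \dim C = k -> forall a : 'rV[K]_k,
  \sum_(j < k) a 0 j *: (vbasis C)`_j = 0 -> a = 0.
Proof.
move=> <- a a0; apply/rowP => j; rewrite mxE.
exact: (freeP (basis_free (vbasisP C)) _ a0).
Qed.

Lemma vbasis_comb_gen (K : fieldType) (V : vectType K) (C : {vspace V}) k :
  \dim C = k -> forall v, v \in C ->
  exists a : 'rV[K]_k, v = \sum_(j < k) a 0 j *: (vbasis C)`_j.
Proof.
move=> <- v Cv; exists (\row_j coord (vbasis C) j v).
by rewrite {1}(coord_vbasis Cv); apply: eq_bigr => j _; rewrite mxE.
Qed.

Section HeisenbergSplitting.
Variables (K : fieldType) (L : lieVectType K) (k : nat).
Variables (y z : L) (C : {vspace L}).
Local Notation w := (lie y z).
Hypothesis w0 : w != 0.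
Hypothesis dC : \dim C = k.
Hypothesis wC : w \notin C.
Hypothesis cen : forall s x : L, s \in (<[w]> + C)%VS -> lie s x = 0.
Hypothesis gen : forall x, exists a b : K, x + a *: z - b *: y \in (<[w]> + C)%VS.

Local Notation H := (heisenberg K * abelian_lie K k)%type.

Let basisC (a : 'rV[K]_k) : L := \sum_(j < k) a 0 j *: (vbasis C)`_j.

Lemma basisC_mem a : basisC a \in C.
Proof.
apply: memv_suml => j _; apply/memvZ/vbasis_mem/mem_nth.
by rewrite size_tuple dC.
Qed.

Definition heisenberg_split (u : H) : L :=
  (u.1 : 'rV[K]_3) 0 (inord 0) *: y + (u.1 : 'rV[K]_3) 0 (inord 1) *: z +
  ((u.1 : 'rV[K]_3) 0 (inord 2) *: w + basisC u.2).

Lemma heisenberg_split_linear : linear heisenberg_split.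
Proof.
move=> a u v; rewrite /heisenberg_split /basisC /= !mxE !scalerDl -!scalerA.
rewrite !scalerDr scaler_sumr.
have -> : \sum_(j < k) (a *: u + v).2 0 j *: (vbasis C)`_j =
  \sum_(j < k) a *: (u.2 0 j *: (vbasis C)`_j) +
  \sum_(j < k) v.2 0 j *: (vbasis C)`_j.
  by rewrite -big_split; apply: eq_bigr => j _; rewrite !mxE scalerDl scalerA.
by rewrite [X in X + _]addrACA [X in _ + X]addrACA; apply: addrACA.
Qed.

HB.instance Definition _ := GRing.isLinear.Build K H L *:%R
  heisenberg_split heisenberg_split_linear.

Lemma heisenberg_split_lie u v :
  heisenberg_split (lie u v) = lie (heisenberg_split u) (heisenberg_split v).
Proof.
(* The w- and C-parts of both arguments are central, so only the coordinates along y and z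
   contribute. *)
have cw a q : q \in C -> a *: w + q \in (<[w]> + C)%VS.
  by move=> Cq; apply: memv_add => //; apply/memvZ/memv_line.
rewrite [RHS]lieDl (cen _ (cw _ _ (basisC_mem _))) addr0.
rewrite linearD /= [X in _ + X]lieC (cen _ (cw _ _ (basisC_mem _))) oppr0 addr0.
rewrite lieDl !lieZl !linearD /= !linearZ /= !lie_alternating !scaler0 addr0 add0r.
rewrite [lie z y]lieC !scalerN !scalerA -scalerBl.
rewrite /heisenberg_split /lie /= /prod_bracket /= /lie /= /heisenberg_bracket.
rewrite /abelian_bracket /hz !mxE /= /basisC.
rewrite [X in _ + (_ + X)]big1 => [|j _]; last by rewrite mxE scale0r.
have -> : (inord 0 == inord 2 :> 'I_3) = false.
  by apply/negbTE; rewrite -val_eqE /= !inordK.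
have -> : (inord 1 == inord 2 :> 'I_3) = false.
  by apply/negbTE; rewrite -val_eqE /= !inordK.
rewrite eqxx !mulr0 !scale0r !add0r addr0 mulr1.
by congr ((_ - _) *: _); rewrite mulrC.
Qed.

(** On a kernel element, bracketing with [z] isolates the y-coordinate times w, and bracketing with
    [y] the z-coordinate; the w-coordinate then vanishes because w is not in [C]. *)
Lemma heisenberg_split_inj : injective heisenberg_split.
Proof.
suff ker0 u : heisenberg_split u = 0 -> u = 0.
  move=> u v e; apply/eqP; rewrite -subr_eq0; apply/eqP/ker0.
  by rewrite linearB /= e subrr.
case: u => h a e; have := e; rewrite /heisenberg_split /=.
set c := _ + basisC a => e0.
have cc q : lie c q = 0.
  apply: cen; apply: memv_add; last exact: basisC_mem.
  by apply/memvZ/memv_line.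
have h0 : (h : 'rV[K]_3) 0 (inord 0) = 0.
  have := congr1 (fun x => lie x z) e0; rewrite lieDl cc lieDl !lieZl lie_alternating.
  rewrite scaler0 !addr0 lie0l => /eqP; rewrite scaler_eq0 (negPf w0) orbF.
  by move/eqP.
have h1 : (h : 'rV[K]_3) 0 (inord 1) = 0.
  have := congr1 (lie y) e0; rewrite linearD /= [lie y c]lieC cc oppr0 addr0.
  rewrite linearD /= !linearZ /= lie_alternating scaler0 add0r linear0 => /eqP.
  by rewrite scaler_eq0 (negPf w0) orbF => /eqP.
move: e0; rewrite h0 h1 !scale0r !add0r /c => {cc} {}e0.
have h2 : (h : 'rV[K]_3) 0 (inord 2) = 0.
  apply: contraNeq wC => h2; rewrite -[w]scale1r -(mulVf h2) -scalerA.
  apply: memvZ; move/eqP: e0; rewrite addr_eq0 => /eqP ->.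
  by rewrite memvN basisC_mem.
move: e0; rewrite h2 scale0r add0r => e0.
congr pair.
  apply/rowP => j; rewrite mxE.
  case: j => [[|[|[|//]]] lt].
  - rewrite -[RHS]h0; apply: (congr1 (fun i => (h : 'rV[K]_3) 0 i)).
    by apply: val_inj; rewrite /= inordK.
  - rewrite -[RHS]h1; apply: (congr1 (fun i => (h : 'rV[K]_3) 0 i)).
    by apply: val_inj; rewrite /= inordK.
  - rewrite -[RHS]h2; apply: (congr1 (fun i => (h : 'rV[K]_3) 0 i)).
    by apply: val_inj; rewrite /= inordK.
by have := vbasis_comb_free dC e0.
Qed.

Lemma heisenberg_split_surj x : exists u, heisenberg_split u = x.
Proof.
have [a [b /memv_addP [_ /vlineP [d ->] [q Cq e]]]] := gen x.
have [r] := vbasis_comb_gen dC Cq; rewrite -/(basisC r) => qr.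
pose h : 'rV[K]_3 := \row_j [:: b; - a; d]`_j.
exists (h, r); rewrite /heisenberg_split /= -qr /h !mxE /= !inordK //= -e.
by rewrite scaleNr addrC addrA subrK addrK.
Qed.

Lemma heisenberg_splitting : lie_isomorphic L H.
Proof.
have [f gf] := choice heisenberg_split_surj.
have fg : cancel heisenberg_split f.
  exact: inj_can_sym gf heisenberg_split_inj.
have lf : linear f by move=> a u v; apply: (can2_linear fg gf).
exists (HB.pack f (GRing.isLinear.Build K L H *:%R f lf) : {linear L -> H}).
split; last by exists heisenberg_split.
move=> u v; apply: heisenberg_split_inj.
by rewrite heisenberg_split_lie /= !gf.
Qed.

End HeisenbergSplitting.

Lemma linear_bij_dim (K : fieldType) (U V : vectType K) (f : {linear U -> V}) :
  bijective f -> \dim {:U} = \dim {:V}.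
Proof.
case=> g fK gK; have f0 : lker (linfun f) == 0%VS.
  by apply/lker0P => u v; rewrite !lfunE => /(can_inj fK).
rewrite -(limg_dim_eq (f := linfun f)) ?(eqP f0) ?capv0 //; congr (\dim _).
apply/eqP; rewrite eqEsubv subvf /=; apply/subvP => v _.
by rewrite -[v]gK -[f _](lfunE f) memv_img ?memvf.
Qed.

Lemma dim_heisenberg_sum (K : fieldType) k :
  \dim {:(heisenberg K * abelian_lie K k)%type} = (3 + k)%N.
Proof. by rewrite dimvf /dim /= /dim /= !mul1n. Qed.

Lemma lie_isomorphic_dim (K : fieldType) (L : lieVectType K) k :
  lie_isomorphic L (heisenberg K * abelian_lie K k)%type ->
  \dim {:L} = (3 + k)%N.
Proof.
move=> [f [_ bijf]]; rewrite -(dim_heisenberg_sum K k).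
exact: (@linear_bij_dim K L (heisenberg K * abelian_lie K k)%type f bijf).
Qed.

(** * Algebras attaining the bound with one-dimensional derived subalgebra *)

Section EqualityCase.
Variables (K : fieldType) (L : lieVectType K) (c : nat).

Local Notation D := (lie_derived L).

(** The numerical hypothesis reverses the inequality of [dim_relv_bound] at [\dim D = 1], that is,
    it says that the bound is attained. *)
Lemma heisenberg_of_large_multiplier :
  lower_central L c = 0%VS -> ~ lie_abelian L -> \dim D = 1%N ->
  (2 * \dim (relv L) + 4 + (\dim {:L} - 1) * (\dim {:L} - 1) <=
   2 * (\dim {:L} * \dim {:L}) + (\dim {:L} - 1))%N ->
  lie_isomorphic L (heisenberg K * abelian_lie K (\dim {:L} - 3))%type.
Proof.
move=> nilL nab dD large.
have [U [y [z [sU ED dU]]]] := derived_generator nilL nab.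
have U0 : U = 0%VS by apply/eqP; rewrite -dimv_eq0; apply/eqP; lia.
rewrite {}U0 add0v in sU ED dU; set w := lie y z in ED.
have w0 : w != 0.
  by move: dD; rewrite ED dim_vline; case: (w != 0).
have cw x : lie w x = 0.
  apply/eqP; rewrite -memv0; apply: (subvP sU).
  by apply: mem_lie_prodv; rewrite ?memvf // ED memv_line.
have lieD u v : exists a, lie u v = a *: w.
  by apply/vlineP; rewrite -ED; apply: mem_lie_prodv; apply: memvf.
(* Otherwise [reltens D] would equal [relv L], and the flag above [D] alone would improve the
   doubled bound by 4. *)
have notrel : (tens w y \notin relv L) \/ (tens w z \notin relv L).
  apply: contrapT => H.
  have wy : tens w y \in relv L by apply: contrapT => /negP ?; apply: H; left.
  have wz : tens w z \in relv L by apply: contrapT => /negP ?; apply: H; right.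
  have sD : (D <= 0 + <[w]>)%VS by rewrite add0v ED.
  have := reltens_hyperplane_derived (sub0v 0%VS) sD.
  rewrite -/w add0v -ED reltens0 => sR.
  have sRJ : (reltens D <= relv L)%VS.
    by apply: subv_trans sR _; rewrite !subv_add subvv -!memvE wy wz.
  have := dimvS sRJ; have := dim_reltens_top (subvv D); rewrite dD.
  by lia.
pose S := (lker (linfun (lie y)) :&: lker (linfun (lie z)))%VS.
have memS s : (s \in S) = (lie y s == 0) && (lie z s == 0).
  by rewrite memv_cap !memv_ker !lfunE.
(* For u equal to y or z, the Jacobi relator of u, s, s' reduces to [tens u (lie s s')]. A nonzero
   [s, s'] would be a multiple of w and make both [tens w y] and [tens w z] relators. *)
have relS s s' : s \in S -> s' \in S -> lie s s' = 0.
  rewrite !memS => /andP [/eqP ys /eqP zs] /andP [/eqP ys' /eqP zs'].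
  have rel u : lie u s = 0 -> lie u s' = 0 -> tens u (lie s s') \in relv L.
    move=> us us'; have := relv_jac u s s'; rewrite /jactens us [lie s' u]lieC us'.
    by rewrite oppr0 !linear0 !addr0.
  have [a Ea] := lieD s s'; have [a0|a0] := eqVneq a 0.
    by rewrite Ea a0 scale0r.
  have relw u : tens u (lie s s') \in relv L -> tens w u \in relv L.
    rewrite Ea linearZ /= => Ru.
    rewrite -[tens w u](addrK (tens u w)); apply: memvB; first exact: relv_tensC.
    by rewrite -[tens u w]scale1r -(mulVf a0) -scalerA; apply: memvZ.
  by case: notrel => /negP []; apply/relw/rel.
have genS x : exists a b : K, x + a *: z - b *: y \in S.
  have [a Ea] := lieD y x; have [b Eb] := lieD z x.
  exists (- a), (- b); rewrite memS !linearD /= !linearN /= !linearZ /=.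
  rewrite !lie_alternating Ea Eb [lie z y]lieC -/w !scaleNr !scalerN !scaler0.
  by rewrite !opprK oppr0 !addr0 !subrr eqxx.
(* [S], y and z together span L, and s commutes with each of them. *)
have cenS s x : s \in S -> lie s x = 0.
  move=> Ss; have [a [b /(relS s _ Ss)]] := genS x.
  move: Ss; rewrite memS => /andP [/eqP ys /eqP zs].
  rewrite linearB linearD /= !linearZ /= [lie s z]lieC [lie s y]lieC ys zs.
  by rewrite !(oppr0, scaler0, addr0).
have wS : w \in S by rewrite memS ![lie _ w]lieC !cw oppr0 eqxx.
pose C := (S :\: <[w]>)%VS.
have ES : S = (<[w]> + C)%VS.
  by rewrite addvC addv_diff; apply/esym/addv_idPl.
have wC : w \notin C.
  apply: contra w0 => Cw; rewrite -memv0 -(capv_diff S <[w]>) memv_cap Cw /=.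
  exact: memv_line.
have iso : lie_isomorphic L (heisenberg K * abelian_lie K (\dim C))%type.
  by apply: (@heisenberg_splitting _ _ _ y z C w0 (erefl _) wC); rewrite -/w -ES //.
by rewrite (lie_isomorphic_dim iso) addKn.
Qed.

End EqualityCase.

(** * The multiplier of H(1) plus an abelian summand *)

(** Exactly [k] of the increasing pairs start at 2, the index of [hz]. The remaining pairs index the
    minors used in [heisenberg_relv_bound]. *)
Lemma card_heisenberg_pairs k :
  (2 * #|[set q : 'I_(3 + k) * 'I_(3 + k) |
           (q.1 < q.2)%N && (val q.1 != 2)]| + 2 * k = (3 + k) * (2 + k))%N.
Proof.
rewrite -sum1_card (eq_bigl (fun q : 'I_(3 + k) * 'I_(3 + k) =>
  (val q.1 != 2) && (q.1 < q.2)%N)); last by move=> q; rewrite inE andbC.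
rewrite -(pair_big_dep (fun i : 'I_(3 + k) => val i != 2)
  (fun i j : 'I_(3 + k) => (i < j)%N) (fun _ _ => 1%N)) /=.
have inner (i : 'I_(3 + k)) : (\sum_(j < 3 + k | i < j) 1 = 2 + k - i)%N.
  rewrite -(big_mkord (fun j => (i < j)%N) (fun=> 1%N)).
  rewrite (big_cat_nat (n := i.+1)) //= big_nat_cond big_pred0 => [|j]; last first.
    by apply/negbTE; lia.
  rewrite add0n big_nat_cond (eq_bigl (fun j => (i.+1 <= j < 3 + k)%N)); last first.
    by move=> j; lia.
  by rewrite -big_nat sum_nat_const_nat muln1; lia.
rewrite (eq_bigr _ (fun i _ => inner i)).
have two : (2 < 3 + k)%N by [].
have all : (2 * \sum_(i < 3 + k) (2 + k - i) = (3 + k) * (2 + k))%N.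
  (* Reversing the index turns the summand into [i], whose sum is a binomial coefficient. *)
  rewrite (reindex_inj rev_ord_inj) /=.
  have -> : (\sum_(i < 3 + k) (2 + k - (3 + k - i.+1)) = \sum_(i < 3 + k) i)%N.
    by apply: eq_bigr => i _; have := ltn_ord i; lia.
  rewrite -(big_mkord xpredT (fun i => i)) bin2_sum bin2 mul2n.
  rewrite halfK; have : odd ((3 + k) * (3 + k).-1) = false; last by move=> ->; lia.
  by rewrite (_ : 3 + k = k.+3)%N // oddM /=; case: (odd k).
rewrite -all [in RHS](bigD1 (Ordinal two)) //= mulnDr [in RHS]addnC.
by congr (_ * _ + _)%N; lia.
Qed.

Section HeisenbergMultiplier.
Variables (K : fieldType) (L : lieVectType K) (k : nat).

Local Notation H := (heisenberg K * abelian_lie K k)%type.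
Local Notation P := [set q : 'I_(3 + k) * 'I_(3 + k) |
  (q.1 < q.2)%N && (val q.1 != 2)].

Local Notation i0 := (lshift k (inord 0 : 'I_3)).
Local Notation i1 := (lshift k (inord 1 : 'I_3)).
Local Notation i2 := (lshift k (inord 2 : 'I_3)).

Lemma heisenberg_coordinates : lie_isomorphic L H ->
  exists psi : L -> 'rV[K]_(3 + k),
  [/\ linear psi,
      forall x y, psi (lie x y) =
        (psi x 0 i0 * psi y 0 i1 - psi x 0 i1 * psi y 0 i0) *: delta_mx 0 i2
    & forall v, exists x, psi x = v].
Proof.
move=> [f [fm [g fK gK]]].
exists (fun x => row_mx ((f x).1 : 'rV[K]_3) ((f x).2 : 'rV[K]_k)); split.
- by move=> a x y; rewrite linearP /= scale_row_mx add_row_mx.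
- move=> x y; rewrite !row_mxEl fm /= /lie /= /prod_bracket /= /lie /=.
  rewrite /heisenberg_bracket /abelian_bracket /hz.
  apply/rowP => j; rewrite mxE [RHS]mxE; case: splitP => l El.
    rewrite !mxE eqxx /=; congr (_ * (_)%:R).
    by rewrite -!val_eqE /= El.
  rewrite !mxE eqxx /=; have -> : (j == i2) = false; last by rewrite mulr0.
  by apply/negbTE; rewrite -val_eqE /= El inordK.
- by move=> v; exists (g (lsubmx v, rsubmx v)); rewrite gK /= hsubmxK.
Qed.

(** The 2 by 2 minors of the coordinates of x and y, taken at the pairs of [P], vanish on all
    relators and are linearly independent, so [relv L] has codimension at least [#|P|]. *)
Lemma heisenberg_relv_bound : lie_isomorphic L H ->
  (\dim (relv L) + #|P| <= \dim {:L} * \dim {:L})%N.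
Proof.
move=> /heisenberg_coordinates [psi [psil psi_lie psiS]].
pose h x y : 'rV[K]_#|P| := \row_q
  (psi x 0 (enum_val q).1 * psi y 0 (enum_val q).2 -
   psi x 0 (enum_val q).2 * psi y 0 (enum_val q).1).
have hl y : linear (h ^~ y).
  by move=> a u v; apply/rowP => q; rewrite !mxE psil !mxE; ring.
have hr x : linear (h x).
  by move=> a u v; apply/rowP => q; rewrite !mxE psil !mxE; ring.
pose Phi : 'Hom('M[K]_(dim L), 'rV[K]_#|P|) := linfun (tlift h).
have PhiE x y : Phi (tens x y) = h x y by rewrite lfunE /= tliftE.
have JPhi : (relv L <= lker Phi)%VS.
  apply: relv_sub => [x|x y z]; rewrite memv_ker ?linearD /= !PhiE.
    by apply/eqP/rowP => q; rewrite !mxE mulrC subrr.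
  apply/eqP/rowP => q; rewrite !mxE !psi_lie !mxE /=.
  have := enum_valP q; rewrite inE; case: (enum_val q) => i j /= /andP [ij i2'].
  have -> : (i == i2) = false.
    by apply: contraNF i2' => /eqP ->; rewrite /= inordK.
  (* Brackets have only the coordinate 2, so the Jacobi sum is trivial unless j = 2. Then i is 0 or
     1, and the sum is a determinant of order 3 with a repeated row. *)
  rewrite !mulr0 !subr0; have [ej|] := eqVneq j i2; last by rewrite !mulr0 !addr0.
  rewrite !mulr1; have : (i < 2)%N by move: ij; rewrite ej /= inordK.
  move=> lti; have [->|->] : i = i0 \/ i = i1.
    have [e|e] : nat_of_ord i = 0%N \/ nat_of_ord i = 1%N by lia.
      by left; apply: val_inj; rewrite /= e inordK.
    by right; apply: val_inj; rewrite /= e inordK.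
    by move: (psi x 0 i0) (psi x 0 i1) (psi y 0 i0) (psi y 0 i1)
      (psi z 0 i0) (psi z 0 i1) => *; ring.
  by move: (psi x 0 i0) (psi x 0 i1) (psi y 0 i0) (psi y 0 i1)
    (psi z 0 i0) (psi z 0 i1) => *; ring.
have Phif : limg Phi = fullv.
  apply/eqP; rewrite eqEsubv subvf /=; apply/subvP => v _.
  rewrite [v]row_sum_delta; apply: memv_suml => q _; apply: memvZ.
  have [x Ex] := psiS (delta_mx 0 (enum_val q).1).
  have [y Ey] := psiS (delta_mx 0 (enum_val q).2).
  have <- : Phi (tens x y) = delta_mx 0 q; last by rewrite memv_img ?memvf.
  rewrite PhiE; apply/rowP => r; rewrite !mxE Ex Ey !mxE !eqxx /=.
  have := enum_valP q; have := enum_valP r; rewrite !inE => /andP [lr _] /andP [lq _].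
  have -> : (r == q) = (enum_val r == enum_val q) by rewrite (inj_eq enum_val_inj).
  case: (enum_val r) (enum_val q) lr lq => [i j] [i' j'] /= lr lq.
  (* Both pairs are increasing, so neither is the swap of the other and the negative term of the
     minor vanishes. *)
  rewrite xpair_eqE -!natrM !mulnb; have -> : (j == i') && (i == j') = false.
    apply/negbTE/negP => /andP [/eqP ji /eqP ij]; move: lr lq.
    by rewrite ji ij; lia.
  by rewrite subr0.
have dPhi : (\dim (lker Phi) + #|P| = \dim {:L} * \dim {:L})%N.
  have dV : \dim {:'rV[K]_#|P|} = #|P| by rewrite dimvf [LHS]dim_matrix; apply: mul1n.
  have dM : \dim {:'M[K]_(dim L)} = (\dim {:L} * \dim {:L})%N.
    by rewrite !dimvf [LHS]dim_matrix.
  rewrite -[RHS]dM -[RHS](limg_ker_dim Phi fullv) Phif capfv.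
  by congr (_ + _)%N; apply: esym.
by rewrite -dPhi leq_add2r dimvS.
Qed.

End HeisenbergMultiplier.

(** * Assembling the bound and the equality case *)

(** [A] is spanned by representatives of a basis of the quotient; their independence modulo [D]
    gives both the trivial intersection and the dimension. *)
Lemma quot_dim_complement (K : fieldType) (V : vectType K) (Z D : {vspace V}) t :
  quot_dim [set` Z] [set` (Z :&: D)%VS] t ->
  exists A : {vspace V}, [/\ (A <= Z)%VS, (A :&: D = 0)%VS & \dim A = t].
Proof.
move=> [v [Zv vfree _]]; pose X := [tuple v j | j < t].
have XE (j : 'I_t) : X`_j = v j by rewrite -tnth_nth tnth_mktuple.
have sXZ : (<<X>> <= Z)%VS.
  by apply/span_subvP => _ /tnthP [j ->]; rewrite tnth_mktuple; apply: Zv.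
have combE (a : 'I_t -> K) : \sum_j a j *: v j = \sum_j a j *: X`_j.
  by apply: eq_bigr => j _; rewrite XE.
have combZ (a : 'I_t -> K) : \sum_j a j *: v j \in Z.
  by apply: memv_suml => j _; apply/memvZ/Zv.
exists <<X>>%VS; split=> //.
- apply/eqP; rewrite -subv0; apply/subvP => x.
  rewrite memv_cap memv0 => /andP [/coord_span -> Dx].
  rewrite big1 // => j _; rewrite (vfree (fun j => coord X j x)) ?scale0r //=.
  by rewrite memv_cap combZ combE.
- have fX : free X.
    apply/freeP => a; rewrite -combE => a0; apply: vfree.
    by rewrite a0 /=; apply: mem0v.
  by move/eqP: fX; rewrite size_tuple.
Qed.

Theorem theorem2p11 (K : fieldType) (L : lieVectType K) (n m c t : nat)
    (X : Type) (F : lieAlgType K) (i : X -> F) (p : {linear F -> L})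
    (hn : \dim {:L} = n)
    (hm : \dim (lie_derived L) = m)
    (hna : ~ lie_abelian L)
    (hc : nilpotent_of_class L c)
    (ht : quot_dim [set` lie_center L]
                   [set` (lie_center L :&: lie_derived L)%VS] t)
    (hF : free_presentation i p) :
  let bound : rat :=
    2%:R^-1 * (n%:R + m%:R - 2%:R) * (n%:R - m%:R - 1)
      - t%:R * (m%:R - 1) + 1 in
  exists d : nat,
    [/\ schur_multiplier_dim p d,
        d%:R <= bound
      & m = 1%N ->
        (d%:R = bound <->
         lie_isomorphic L (heisenberg K * abelian_lie K (n - 3))%type)].
Proof.
set d := (\dim (lker (bracket_map L)) - \dim (relv L))%N.
have dE : (d + \dim (relv L) + m = n * n)%N.
  rewrite /d subnK; last exact/dimvS/relv_sub_ker.
  by rewrite -hm -hn dim_ker_bracket_map dimvf.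
have m0 : (0 < m)%N.
  rewrite -hm lt0n dimv_eq0; apply/eqP => D0; apply: hna => x y; apply/eqP.
  by rewrite -memv0 -D0; apply: mem_lie_prodv; apply: memvf.
have [A [Ac AD dA]] := quot_dim_complement ht.
case: hc => nilL _.
(* [r] is the codimension of the direct sum of [lie_derived L] and [A]. *)
have [r nE] : exists r, n = (m + t + r)%N.
  have /dimv_disjoint_sum : (lie_derived L :&: A = 0)%VS by rewrite capvC.
  have := dimvS (subvf (lie_derived L + A)); rewrite hn hm dA => le dDA.
  by exists (n - (m + t))%N; lia.
(* After substituting n = m + t + r, the doubled bound coincides with the estimate of
   [dim_relv_bound]. *)
have dle : 2 * d%:R <= (n%:R + m%:R - 2) * (n%:R - m%:R - 1)
    - 2 * t%:R * (m%:R - 1) + 2 :> rat.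
  have := dim_relv_bound nilL hna Ac AD (r := r).
  rewrite hn hm dA => /(_ nE).
  rewrite -(ler_nat rat) !(natrD, natrM) -subn1 natrB //.
  move: dE => /(congr1 (fun k => k%:R : rat)); rewrite nE !(natrD, natrM).
  by nra.
exists d; split=> [||m1].
- exact: schur_multiplier_dimE hF.
- lra.
split=> [|iso].
- move=> deq; rewrite -hn.
  apply: heisenberg_of_large_multiplier nilL hna _ _; first by rewrite hm.
  have n1 : (1 <= n)%N by rewrite nE m1; lia.
  rewrite hn -(ler_nat rat) !(natrD, natrM) natrB //.
  move: dE deq => /(congr1 (fun k => k%:R : rat)); rewrite m1 !(natrD, natrM).
  by nra.
- apply/eqP; rewrite eq_le; apply/andP; split; first by lra.
  have nE' : n = (3 + (n - 3))%N by rewrite -[LHS]hn (lie_isomorphic_dim iso).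
  (* With n = 3 + k, the count (3 + k)(2 + k) / 2 - k equals (n - 1)(n - 2) / 2 + 2; subtracting m =
     1 gives the bound as a lower estimate of [d]. *)
  have := heisenberg_relv_bound iso; have := card_heisenberg_pairs (n - 3).
  rewrite hn; move: dE; rewrite m1 nE'; move: (n - 3)%N => k.
  rewrite !addKn; set P := #|_|; move: P => P.
  move=> /(congr1 (fun k => k%:R : rat)) dE /(congr1 (fun k => k%:R : rat)) cP.
  rewrite -(ler_nat rat); move: dE cP; rewrite !(natrD, natrM).
  by nra.
Qed.
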